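(* For any $0<\mu\le 2$, there exist positive constants $C_1$ and $C_2$ such that for the random graph process $\{G_t: t\ge 1\}$ with parameter $\mu$, $$C_1k^{-3}\le\liminf_{t\to\infty}\frac{\overline{D}_k(t)}{t}\le\limsup_{t\to\infty}\frac{\overline{D}_k(t)}{t}\le C_2k^{-3}$$ for all $k\ge 1$.
   Context: Here $u\wedge v=\min(u,v)$. For a parameter $\mu>0$, the random graph process $\{G_t=(V_t,E_t):t\ge1\}$ is defined as follows. Time-Step 1: $G_1$ consists of two vertices $x_0,x_1$ and the edge $\langle x_0,x_1\rangle$. Time-Step $t\ge 2$: a new vertex $x_t$ is added to $G_{t-1}$, and then random edges incident with $x_t$ are added: given $G_{t-1}$, for each $0\le i\le t-1$ the edge $\langle x_i,x_t\rangle$ is added independently with probability $\frac{\mu\, d_{x_i}(t-1)}{2e_{t-1}}\wedge 1$, where $d_{x_i}(t-1)$ is the degree of $x_i$ in $G_{t-1}$ and $e_{t-1}=|E_{t-1}|$. Thus $V_t=\{x_0,\dots,x_t\}$. $D_k(t)$ denotes the number of vertices of degree $k$ in $G_t$ and $\overline{D}_k(t)=\mathbb{E}(D_k(t))$. *)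

(* Defs.v *)
From mathcomp Require Import all_boot all_order all_algebra.

Set Implicit Arguments.
Unset Strict Implicit.
Unset Printing Implicit Defensive.

(* A graph on the labelled vertices x_0, ..., x_(n-1) is given by its set of
   edges, an edge being the pair of its ends. *)
Definition graph (n : nat) : Type := {set {set 'I_n}}.

Definition degree n (g : graph n) (x : 'I_n) : nat :=
  #|[set e in g | x \in e]|.

Definition num_edges n (g : graph n) : nat := #|g|.

Definition num_degree n (k : nat) (g : graph n) : nat :=
  #|[set x : 'I_n | degree g x == k]|.

Definition old_vertex n (x : 'I_n) : 'I_n.+1 := widen_ord (leqnSn n) x.

Definition new_edge n (x : 'I_n) : {set 'I_n.+1} := [set old_vertex x; ord_max].

(* The vertex ord_max is new, and N is its set of neighbours. *)
Definition add_vertex n (g : graph n) (N : {set 'I_n}) : graph n.+1 :=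
  [set (@old_vertex n) @: (e : {set 'I_n}) | e in g] :|:
  [set new_edge x | x in N].

From mathcomp Require Import all_classical all_reals all_analysis.
Import Order.TTheory GRing.Theory Num.Theory.

Local Open Scope classical_set_scope.
Local Open Scope ring_scope.

Definition cond_prob d (T : measurableType d) (R : realType)
  (P : probability T R) (A B : set T) : R :=
  fine (P (A `&` B)) / fine (P B).

Definition cond_independent d (T : measurableType d) (R : realType)
  (P : probability T R) (I : finType) (A : I -> set T) (B : set T) : Prop :=
  forall J : {set I},
    cond_prob P (\big[setI/setT]_(i in J) A i) B =
    \prod_(i in J) cond_prob P (A i) B.

Definition attach_prob (R : realType) (mu : R) n (g : graph n) (x : 'I_n) : R :=
  Num.min (mu * (degree g x)%:R / (2 * (num_edges g)%:R)) 1.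

(* G t is the graph on x_0, ..., x_t at time t; only times t >= 1 matter, and
   G 0 is unconstrained.  As the vertices are labelled by their arrival times,
   G t determines G 1, ..., G t.-1 (by process_step), so that conditioning on
   G t is conditioning on the whole past. *)
Record random_graph_process d (T : measurableType d) (R : realType)
  (P : probability T R) (mu : R) (G : forall t : nat, T -> graph t.+1) : Prop :=
{ process_measurable : forall t (g : graph t.+1), (0 < t)%N ->
    measurable [set w | G t w = g];
  process_start : forall w, G 1%N w = [set [set ord0; ord_max]]%SET;
  process_step : forall t w, (0 < t)%N ->
    exists N : {set 'I_t.+1}, G t.+1 w = add_vertex (G t w) N;
  process_prob : forall t (g : graph t.+1), (0 < t)%N ->
    (0 < P [set w | G t w = g])%E ->
    forall x : 'I_t.+1,
      cond_prob P [set w | new_edge x \in G t.+1 w] [set w | G t w = g] =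
      attach_prob mu g x;
  process_indep : forall t (g : graph t.+1), (0 < t)%N ->
    (0 < P [set w | G t w = g])%E ->
    cond_independent P
      (fun x : 'I_t.+1 => [set w | new_edge x \in G t.+1 w])
      [set w | G t w = g] }.

Definition mean_num_degree d (T : measurableType d) (R : realType)
  (P : probability T R) (G : forall t : nat, T -> graph t.+1) (k t : nat) :
  \bar R :=
  ('E_P[fun w => (num_degree k (G t w))%:R])%E.

(* Main.v *)
Require Import Defs.
From mathcomp Require Import all_boot all_order all_algebra.
From mathcomp Require Import all_classical all_reals all_analysis.
From mathcomp Require Import measurable_realfun ring lra.

(** Why the theorem holds.  Write e_t for the number of edges and D_k for the
    number of vertices of degree k at time t.  A degree is at most e_t, so for
    mu <= 2 the truncation at 1 in the attachment probability never acts: x is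
    joined to the new vertex with probability exactly mu d(x) / (2 e_t).  By the
    handshake lemma the new degree has conditional mean exactly mu and
    conditional variance at most mu, so e_t - mu t is a martingale up to a
    constant and E (e_t - mu t)^2 <= 2 t ([mean_sq_num_edges]).

    Conditioning on the graph at time t gives, for k >= 0,
      E[D_(k+1)(t+1) | G_t] = D_(k+1) - mu (k+1) D_(k+1) / (2 e_t)
                              + mu k D_k / (2 e_t) + q_(k+1),
    where q_j is the conditional probability that the new vertex has degree j
    ([mean_num_degree_add_vertex]).  Since k D_k <= 2 e_t, replacing e_t by mu t
    costs at most |e_t - mu t| / t, whose mean tends to 0
    ([mean_degree_count_step]).
    So the means a_k(t) of D_k obey
      a_(k+1)(t+1) = (1 - (k+1) / (2t)) a_(k+1)(t) + k / (2t) a_k(t)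
                     + E q_(k+1) + o(1),
    and a recursion a(t+1) <= (1 - c/t) a(t) + b(t) with limsup b <= l forces
    limsup a(t)/t <= l / (1 + c) ([limsup_le_recursion]).  Hence the limits of
    a_k(t)/t are controlled by the solutions of
      (1 + (k+1)/2) u_(k+1) = (k/2) u_k + q_(k+1).
    The homogeneous equation is solved by multiples of 1 / (k (k+1) (k+2)),
    which is where the exponent 3 comes from; the source adds
    2 q_k k (k+1) to the multiple at step k.

    It remains to bound the source, uniformly over the graph.  Only bounds are
    needed, so the limit law of the new degree is not identified.  From above,
    E 2^X <= exp(mu) for a sum X of independent Bernoulli variables of total
    mean mu, so q_k <= exp(mu) 2^-k and the multiples stay bounded
    ([bernoulli_card_tail], [upper_profileS]).  From below it is enough that
    q_1 be bounded away from 0: two degrees add up to at most e_t + 1, so once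
    e_t >= 2 at most one attachment probability exceeds 3/4, and then P(X = 1)
    is at least a positive constant ([bernoulli_card1_ge]); e_t < 2 has
    probability O(1/t).

    All of this is finite once the conditional law of the set of neighbours of
    the new vertex is known to be a product of Bernoulli laws.  The product rule
    gives the probability that the set contains any given J, and these
    numbers determine the law ([eq_superset_sums], [law_state]). *)

Set Implicit Arguments.
Unset Strict Implicit.
Unset Printing Implicit Defensive.

Import Order.TTheory GRing.Theory Num.Theory.

Local Open Scope ring_scope.

(** * Sums of independent Bernoulli variables *)

Definition bernoulli_weight (R : nzRingType) (I : finType) (p : I -> R)
    (N : {set I}) : R :=
  \prod_i (if i \in N then p i else 1 - p i).

Section BernoulliAlgebra.
Variables (R : realType) (I : finType) (p : I -> R).
Implicit Types (N J : {set I}).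

Let W := bernoulli_weight p.

(** The generating identity behind the moments below: the expectation of a product
    of functions of the independent indicators factors. *)
Lemma sum_bernoulli_weight_prod (a b : I -> R) :
  \sum_N W N * \prod_i (if i \in N then a i else b i) =
  \prod_i (p i * a i + (1 - p i) * b i).
Proof.
rewrite bigA_distr; apply: eq_bigr => N _.
by rewrite -big_split; apply: eq_bigr => i _ /=; case: ifP.
Qed.

Lemma sum_bernoulli_weight : \sum_N W N = 1.
Proof.
transitivity (\prod_i (p i * 1 + (1 - p i) * 1)); last first.
  by apply: big1 => i _; rewrite !mulr1 subrKC.
rewrite -sum_bernoulli_weight_prod; apply: eq_bigr => N _.
by rewrite big1 ?mulr1 // => i _; case: ifP.
Qed.

Lemma sum_bernoulli_weight_superset J :
  \sum_(N : {set I} | J \subset N) W N = \prod_(i in J) p i.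
Proof.
transitivity (\prod_i (p i * 1 + (1 - p i) * (i \notin J)%:R)); last first.
  rewrite [RHS]big_mkcond; apply: eq_bigr => i _.
  by case: ifP => _; rewrite /= ?mulr1 ?subrKC // mulr0 addr0.
rewrite -sum_bernoulli_weight_prod big_mkcond; apply: eq_bigr => N _.
case: ifPn => [/fintype.subsetP JN | /fintype.subsetPn[x xJ xN]].
  rewrite big1 ?mulr1 // => i _; case: ifPn => // iN.
  by case: (boolP (i \in J)) => // /JN; rewrite (negbTE iN).
by rewrite (bigD1 x) //= (negbTE xN) xJ mul0r mulr0.
Qed.

Lemma sum_bernoulli_weight_mem x : \sum_N W N * (x \in N)%:R = p x.
Proof.
have := sum_bernoulli_weight_superset [set x]; rewrite big_set1 => <-.
by rewrite [RHS]big_mkcond; apply: eq_bigr => N _; rewrite finset.sub1set mulr_natr;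
  case: ifP.
Qed.

Lemma sum_bernoulli_weight_mem2 x y : x != y ->
  \sum_N W N * ((x \in N)%:R * (y \in N)%:R) = p x * p y.
Proof.
move=> xy; have := sum_bernoulli_weight_superset [set x; y].
rewrite big_setU1 ?inE //= big_set1 => <-.
rewrite [RHS]big_mkcond; apply: eq_bigr => N _.
rewrite finset.subUset !finset.sub1set; case: (x \in N); case: (y \in N);
  by rewrite /= ?(mulr0, mul0r, mulr1).
Qed.

Lemma card_sum_mem N : #|N|%:R = \sum_x (x \in N)%:R :> R.
Proof.
rewrite -sum1_card natr_sum big_mkcond.
by apply: eq_bigr => i _; case: (i \in N).
Qed.

Lemma bernoulli_mean : \sum_N W N * #|N|%:R = \sum_x p x.
Proof.
under eq_bigr => N _ do rewrite card_sum_mem mulr_sumr.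
by rewrite exchange_big; apply: eq_bigr => x _; exact: sum_bernoulli_weight_mem.
Qed.

(** Independence of distinct indicators kills the off-diagonal terms of the
    variance. *)
Lemma bernoulli_covariance x y :
  \sum_N W N * (((x \in N)%:R - p x) * ((y \in N)%:R - p y)) =
  if x == y then p x * (1 - p x) else 0.
Proof.
transitivity (\sum_N W N * ((x \in N)%:R * (y \in N)%:R) - p x * p y).
  have ->: \sum_N W N * (((x \in N)%:R - p x) * ((y \in N)%:R - p y)) =
    \sum_N (W N * ((x \in N)%:R * (y \in N)%:R) - p y * (W N * (x \in N)%:R)
            - p x * (W N * (y \in N)%:R) + p x * p y * W N).
    by apply: eq_bigr => N _; ring.
  rewrite big_split !sumrB -!mulr_sumr !sum_bernoulli_weight_mem.
  rewrite sum_bernoulli_weight /=; ring.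
case: eqVneq => [<-|xy]; last by rewrite sum_bernoulli_weight_mem2 // subrr.
under eq_bigr => N _ do rewrite -natrM mulnb andbb.
by rewrite sum_bernoulli_weight_mem mulrBr mulr1.
Qed.

Lemma bernoulli_variance :
  \sum_N W N * (#|N|%:R - \sum_x p x) ^+ 2 = \sum_x p x * (1 - p x).
Proof.
under eq_bigr => N _.
  rewrite card_sum_mem -sumrB expr2 mulr_suml mulr_sumr.
  under eq_bigr => x _ do rewrite mulr_sumr mulr_sumr.
  over.
rewrite exchange_big; apply: eq_bigr => x _ /=.
rewrite exchange_big (bigD1 x) //= bernoulli_covariance eqxx.
by rewrite big1 ?addr0 // => y /negbTE xy; rewrite bernoulli_covariance eq_sym xy.
Qed.

End BernoulliAlgebra.

Section BernoulliBounds.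
Variables (R : realType) (I : finType) (p : I -> R).
Hypothesis p01 : forall i, 0 <= p i <= 1.
Implicit Types (N : {set I}).

Lemma bernoulli_weight_ge0 N : 0 <= bernoulli_weight p N.
Proof.
apply: prodr_ge0 => i _; have /andP[p0 p1] := p01 i.
by case: ifP => _ //; rewrite subr_ge0.
Qed.

Lemma bernoulli_variance_le :
  \sum_N bernoulli_weight p N * (#|N|%:R - \sum_x p x) ^+ 2 <= \sum_x p x.
Proof.
rewrite bernoulli_variance; apply: ler_sum => x _.
have /andP[p0 p1] := p01 x; nra.
Qed.

(** Exponential Markov inequality: E 2^|N| is the product of the 1 + p i, which is
    at most the exponential of their sum. *)
Lemma bernoulli_card_tail k :
  \sum_(N : {set I} | #|N| == k) bernoulli_weight p N <=
  expR (\sum_x p x) * 2 ^- k.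
Proof.
rewrite ler_pdivlMr ?exprn_gt0 // mulr_suml.
apply: (@le_trans _ _ (\sum_N bernoulli_weight p N *
                       \prod_i (if i \in N then 2 else 1))).
  rewrite big_mkcond; apply: ler_sum => N _.
  rewrite -big_mkcond /= prodr_const.
  case: eqP => [-> //|_]; apply: mulr_ge0 => //; exact: bernoulli_weight_ge0.
rewrite sum_bernoulli_weight_prod expR_sum; apply: ler_prod => i _.
have /andP[p0 p1] := p01 i; have := expR_ge1Dx (p i); lra.
Qed.

(** Since exp (4x) >= 1 + 4x, it suffices that (1 + 4x)(1 - x) >= 1, which holds
    exactly when 0 <= x <= 3/4. *)
Lemma expRN4_le_onem (x : R) : 0 <= x <= 3 / 4 -> expR (- (4 * x)) <= 1 - x.
Proof.
move=> /andP[x0 x1]; rewrite expRN -[_^-1]mul1r ler_pdivrMr ?expR_gt0 //.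
have := expR_ge1Dx (4 * x); nra.
Qed.

Lemma bernoulli_weight_set1 i :
  bernoulli_weight p [set i] = p i * \prod_(j | j != i) (1 - p j).
Proof.
rewrite /bernoulli_weight (bigD1 i) //= inE eqxx; congr (_ * _).
by apply: eq_bigr => j /negbTE ji; rewrite inE ji.
Qed.

Lemma prod_onem_ge i : (forall j, j != i -> p j <= 3 / 4) ->
  expR (- (4 * \sum_x p x)) <= \prod_(j | j != i) (1 - p j).
Proof.
move=> pj; rewrite mulr_sumr -sumrN expR_sum (bigD1 i) //=.
apply: (@le_trans _ _ (\prod_(j | j != i) expR (- (4 * p j)))).
  rewrite ler_piMl //; first by apply: prodr_ge0 => j _; exact: expR_ge0.
  by have /andP[p0 _] := p01 i; rewrite expR_le1; lra.
apply: ler_prod => j ji; rewrite expR_ge0 expRN4_le_onem // pj //.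
by have /andP[-> _] := p01 j.
Qed.

(** When no two of the p i add up to more than 3/2, at most one exceeds 3/4.  If
    there is such a large one, the event that it alone occurs is likely enough;
    otherwise all the events that i alone occurs count, and the weights p i in
    front of them add up to the total mean. *)
Lemma bernoulli_card1_ge :
  (forall i j, i != j -> p i + p j <= 3 / 2) -> \sum_x p x <= 2 ->
  3 / 8 * (\sum_x p x) * expR (- (4 * \sum_x p x)) <=
  \sum_(N : {set I} | #|N| == 1%N) bernoulli_weight p N.
Proof.
move=> p2 m2; set m := \sum_x p x in m2 *; set E := expR _.
have E0 : 0 <= E by exact: expR_ge0.
have m0 : 0 <= m by apply: sumr_ge0 => x _; have /andP[] := p01 x.
have [/existsP[i pi]|/existsPn plt] := boolP [exists i, 3 / 4 <= p i].
  (* A large i: keep only the outcome {i}. *)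
  apply: (@le_trans _ _ (bernoulli_weight p [set i])); last first.
    rewrite (bigD1 [set i]) ?cards1 //= lerDl.
    by apply: sumr_ge0 => N _; exact: bernoulli_weight_ge0.
  rewrite bernoulli_weight_set1; apply: ler_pM => //; [nra|nra|].
  by apply: prod_onem_ge => j ji; have := p2 _ _ ji; lra.
(* No large i: use all the singletons. *)
apply: (@le_trans _ _ (\sum_i bernoulli_weight p [set i])); last first.
  rewrite (eq_bigl (fun N => N \in [set [set i] | i : I])).
    by rewrite big_imset //= => x y _ _; exact: set1_inj.
  by move=> N; apply/cards1P/imsetP => [[x ->]|[x _ ->]]; exists x.
apply: (@le_trans _ _ (m * E)); first by nra.
rewrite mulr_suml; apply: ler_sum => i _; rewrite bernoulli_weight_set1.
have /andP[p0 _] := p01 i; apply: ler_wpM2l => //.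
by apply: prod_onem_ge => j _; have := plt j; rewrite -ltNge => /ltW.
Qed.

End BernoulliBounds.

(** Moebius inversion on the lattice of subsets, by downward induction: the value
    at N is the superset sum at N minus values at strictly larger sets. *)
Lemma eq_superset_sums (R : realType) (I : finType) (u v : {set I} -> R) :
  (forall J : {set I}, \sum_(N : {set I} | J \subset N) u N =
     \sum_(N : {set I} | J \subset N) v N) -> u =1 v.
Proof.
move=> uv N; have [n] := ubnP #|~: N|; elim: n N => // n IH N Nn.
have := uv N; rewrite (bigD1 N) //= [RHS](bigD1 N) //=.
have -> : \sum_(M : {set I} | (N \subset M) && (M != N)) u M =
  \sum_(M : {set I} | (N \subset M) && (M != N)) v M.
  apply: eq_bigr => M NM; apply: IH.
  apply: (@leq_trans #|~: N|); last by rewrite -ltnS.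
  by apply: proper_card; rewrite properC finset.properEneq eq_sym andbC.
exact: addIr.
Qed.

(** * Simple graphs with one vertex added *)

Definition simple_graph n (g : graph n) : Prop := forall e, e \in g -> #|e| = 2%N.

(** Written as sums over edges, degrees and the number of edges all follow from the
    one formula [sum_add_vertex]. *)
Lemma degree_sum n (g : graph n) (x : 'I_n) :
  degree g x = (\sum_(e in g) (x \in e))%N.
Proof.
rewrite /degree -sum1_card [RHS](big_mkcond (mem g)) [LHS]big_mkcond /=.
by apply: eq_bigr => e _; rewrite inE; case: (e \in g); case: (x \in e).
Qed.

Section Graphs.
Variables (n : nat).
Implicit Types (g : graph n) (x y : 'I_n) (N : {set 'I_n}).

Lemma old_vertex_inj : injective (@old_vertex n).
Proof. by move=> x y /(congr1 val) /= xy; exact: val_inj. Qed.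

Lemma old_vertex_neq_max x : (old_vertex x == ord_max) = false.
Proof. by apply/eqP => /(congr1 val) /= xn; have := ltn_ord x; rewrite xn ltnn. Qed.

Lemma mem_old_image x (e : {set 'I_n}) :
  (old_vertex x \in [set old_vertex y | y in e]) = (x \in e).
Proof. exact: mem_imset old_vertex_inj. Qed.

Lemma ord_max_old_image (e : {set 'I_n}) :
  ord_max \notin [set old_vertex y | y in e].
Proof.
by apply/imsetP => -[x _ /eqP]; rewrite eq_sym old_vertex_neq_max.
Qed.

Lemma mem_new_edge x y : (old_vertex x \in new_edge y) = (x == y).
Proof.
by rewrite !inE old_vertex_neq_max orbF (inj_eq old_vertex_inj).
Qed.

Lemma ord_max_new_edge y : ord_max \in new_edge y.
Proof. by rewrite !inE eqxx orbT. Qed.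

Lemma new_edge_inj : injective (@new_edge n).
Proof. by move=> x y xy; apply/eqP; rewrite -mem_new_edge -xy mem_new_edge. Qed.

Lemma sum_add_vertex g N (F : {set 'I_n.+1} -> nat) :
  (\sum_(e in add_vertex g N) F e =
   \sum_(e in g) F [set old_vertex x | x in e] + \sum_(x in N) F (new_edge x))%N.
Proof.
set A := [set [set old_vertex x | x in e] | e : {set 'I_n} in g]%SET.
set B := [set new_edge x | x in N]%SET.
have -> : (\sum_(e in add_vertex g N) F e =
           \sum_(e in [predU A & B]) F e)%N.
  by apply: eq_bigl => e; rewrite inE.
rewrite bigU /=; last first.
  apply/pred0P => e /=; apply/andP => -[/imsetP[e' _ ->] /imsetP[x _ /setP]].
  move=> /(_ ord_max); rewrite ord_max_new_edge.
  by rewrite (negbTE (ord_max_old_image e')).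
rewrite big_imset /=; last by move=> e e' _ _; exact: (imset_inj old_vertex_inj).
by rewrite big_imset //= => x y _ _; exact: new_edge_inj.
Qed.

Lemma num_edges_add_vertex g N :
  num_edges (add_vertex g N) = (num_edges g + #|N|)%N.
Proof. by rewrite /num_edges -!sum1_card sum_add_vertex. Qed.

Lemma degree_add_vertex_old g N x :
  degree (add_vertex g N) (old_vertex x) = (degree g x + (x \in N))%N.
Proof.
rewrite !degree_sum sum_add_vertex; congr addn.
  by apply: eq_bigr => e _; rewrite mem_old_image.
under eq_bigr => y _ do rewrite mem_new_edge.
rewrite big_mkcond (bigD1 x) //= eqxx big1 ?addn0; first by case: ifP.
by move=> y /negbTE xy; rewrite eq_sym xy; case: ifP.
Qed.

Lemma degree_add_vertex_new g N : degree (add_vertex g N) ord_max = #|N|.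
Proof.
rewrite degree_sum sum_add_vertex big1 ?add0n; last first.
  by move=> e _; rewrite (negbTE (ord_max_old_image e)).
by under eq_bigr => y _ do rewrite ord_max_new_edge; rewrite sum1_card.
Qed.

Lemma mem_new_edge_add_vertex g N x : (new_edge x \in add_vertex g N) = (x \in N).
Proof.
rewrite inE (mem_imset _ _ new_edge_inj); case: imsetP => // -[e _ xe].
by have := ord_max_old_image e; rewrite -xe ord_max_new_edge.
Qed.

Lemma simple_add_vertex g N : simple_graph g -> simple_graph (add_vertex g N).
Proof.
move=> sg e; rewrite inE => /orP[] /imsetP[f fin ->].
  by rewrite card_imset ?sg //; exact: old_vertex_inj.
by rewrite cards2 old_vertex_neq_max.
Qed.

Lemma degree_le g x : (degree g x <= num_edges g)%N.
Proof.
by apply: subset_leq_card; apply/fintype.subsetP => e; rewrite inE => /andP[].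
Qed.

Lemma handshake g : simple_graph g -> (\sum_x degree g x = 2 * num_edges g)%N.
Proof.
move=> sg; under eq_bigr => x _ do rewrite degree_sum.
rewrite exchange_big mulnC -sum_nat_const; apply: eq_bigr => e /sg <-.
by rewrite -sum1_card [RHS]big_mkcond; apply: eq_bigr => x _; case: (x \in e).
Qed.

(** Two distinct vertices share at most one edge, the one joining them. *)
Lemma degree_pair_le g x y : simple_graph g -> x != y ->
  (degree g x + degree g y <= (num_edges g).+1)%N.
Proof.
move=> sg xy; rewrite /degree -cardsUI -addn1; apply: leq_add.
  apply: subset_leq_card; apply/fintype.subsetP => e.
  by rewrite !inE => /orP[]/andP[].
rewrite -(cards1 [set x; y]); apply: subset_leq_card.
apply/fintype.subsetP => e; rewrite !inE => /andP[/andP[eg xe] /andP[_ ye]].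
rewrite eq_sym eqEcard finset.subUset !finset.sub1set xe ye /= (sg _ eg).
by rewrite cards2 xy.
Qed.

End Graphs.

Lemma num_degree_sum (R : realType) n k (g : graph n) :
  (num_degree k g)%:R = \sum_x (degree g x == k)%:R :> R.
Proof.
rewrite /num_degree -sum1_card natr_sum big_mkcond.
by apply: eq_bigr => x _; rewrite inE; case: eqP.
Qed.

Section NumDegree.
Variables (R : realType) (n : nat).
Implicit Types (g : graph n) (N : {set 'I_n}).

Lemma num_degree_add_vertex k g N :
  (num_degree k (add_vertex g N))%:R =
  \sum_x ((degree g x == k)%:R +
    (x \in N)%:R * ((degree g x).+1 == k)%:R
    - (x \in N)%:R * (degree g x == k)%:R)
  + (#|N| == k)%:R :> R.
Proof.
rewrite num_degree_sum big_ord_recr /= degree_add_vertex_new; congr (_ + _).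
apply: eq_bigr => x _; rewrite degree_add_vertex_old.
case: (x \in N); rewrite /= ?addn1 ?addn0 ?mul1r ?mul0r ?subr0 ?addr0 //.
by rewrite addrAC subrr add0r.
Qed.

(** The vertices of degree k contribute at most the total degree 2e.  This keeps the
    drift of the degree counts bounded uniformly in k. *)
Lemma num_degree_edges_le k g : simple_graph g ->
  k%:R * (num_degree k g)%:R <= 2 * (num_edges g)%:R :> R.
Proof.
move=> sg; rewrite -!natrM ler_nat -handshake // /num_degree.
rewrite mulnC -sum_nat_const [X in (_ <= X)%N](bigID (fun x => degree g x == k)) /=.
apply: leq_trans (leq_addr _ _).
rewrite [X in (X <= _)%N](eq_bigl (fun x => degree g x == k)).
  by apply: leq_sum => x /eqP ->.
by move=> x; rewrite inE.
Qed.

End NumDegree.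

(** * Upper limits and linear recursions *)

(** Encodes limsup u <= l through real thresholds, which avoids extended reals in
    the recursion; a lower bound on liminf u is stated as an upper bound on
    limsup (- u). *)
Definition limsup_le (R : realType) (u : nat -> R) (l : R) : Prop :=
  forall e, 0 < e -> exists N, forall n, (N <= n)%N -> u n <= l + e.

Section LimSup.
Variable R : realType.
Implicit Types (u a b : nat -> R) (v : nat -> \bar R).

Lemma limsup_leD u1 u2 l1 l2 : limsup_le u1 l1 -> limsup_le u2 l2 ->
  limsup_le (fun n => u1 n + u2 n) (l1 + l2).
Proof.
move=> H1 H2 e e0; have e20 : 0 < e / 2 by rewrite divr_gt0.
have [N1 {}H1] := H1 _ e20; have [N2 {}H2] := H2 _ e20.
exists (maxn N1 N2) => n; rewrite geq_max => /andP[n1 n2].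
have := H1 _ n1; have := H2 _ n2; lra.
Qed.

Lemma limsup_leZ u l k : 0 <= k -> limsup_le u l ->
  limsup_le (fun n => k * u n) (k * l).
Proof.
move=> k0 H e e0; have k1 : 0 < k + 1 by lra.
have [|N {}H] := H (e / (k + 1)); first by rewrite divr_gt0.
exists N => n /H un; apply: (@le_trans _ _ (k * (l + e / (k + 1)))).
  exact: ler_wpM2l.
rewrite mulrDr lerD2l mulrCA -[leRHS]mulr1 ler_pM2l //.
by rewrite ler_pdivrMr //; lra.
Qed.

Lemma le_limsup_le u1 u2 l : (forall n, (0 < n)%N -> u1 n <= u2 n) ->
  limsup_le u2 l -> limsup_le u1 l.
Proof.
move=> u12 H e /H[N {}H]; exists (maxn N 1) => n.
by rewrite geq_max => /andP[/H Hn /u12 un]; exact: le_trans un Hn.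
Qed.

Lemma limsup_le_cst (l : R) : limsup_le (fun=> l) l.
Proof. by move=> e e0; exists 0%N => n _; rewrite lerDl ltW. Qed.

Lemma limsup_le_approx u l : (forall s, 0 < s -> limsup_le u (l + s)) ->
  limsup_le u l.
Proof.
move=> H e e0; have e20 : 0 < e / 2 by rewrite divr_gt0.
have [N {}H] := H _ e20 _ e20; exists N => n /H; lra.
Qed.

Lemma limsup_le_inv (C : R) : limsup_le (fun n => C / n%:R) 0.
Proof.
move=> e e0; have [N HN] : exists N, `|C| / e < N%:R.
  by exists (Num.bound (`|C| / e)); apply: archi_boundP; rewrite divr_ge0 // ltW.
exists N => n Nn; rewrite add0r.
have Nn' : N%:R <= n%:R :> R by rewrite ler_nat.
have n0 : 0 < n%:R :> R.
  by apply: lt_le_trans Nn'; apply: le_lt_trans HN; rewrite divr_ge0 // ltW.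
rewrite ler_pdivrMr //; apply: (le_trans (ler_norm C)).
by rewrite mulrC -ler_pdivrMr //; apply: (le_trans (ltW HN)).
Qed.

(** With g slightly above l / (1 + c), the line g t is a supersolution, so the
    excess a t - g t is multiplied at each step by a factor in [0, 1], up to a
    nonpositive error, as soon as t >= c and b t <= g (1 + c).  It therefore stays
    bounded, and disappears after division by t. *)
Lemma limsup_le_recursion a b c l : 0 <= c ->
  (forall t, (0 < t)%N -> a t.+1 <= (1 - c / t%:R) * a t + b t) ->
  limsup_le b l -> limsup_le (fun t => a t / t%:R) (l / (1 + c)).
Proof.
move=> c0 rec Hb e e0; have c1 : 0 < 1 + c by lra.
have [|N1 {}Hb] := Hb (e / 2 * (1 + c)).
  by rewrite mulr_gt0 // divr_gt0.
set g := l / (1 + c) + e / 2.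
have gE : g * (1 + c) = l + e / 2 * (1 + c).
  by rewrite /g; field; rewrite gt_eqF.
have [N2 HN2] : exists N, c < N%:R.
  by exists (Num.bound c); exact: archi_boundP.
pose N := (maxn N1 N2).+1.
pose M := Num.max (a N - g * N%:R) 0.
have M0 : 0 <= M by rewrite le_max lexx orbT.
(* M is the positive part of the excess at time N. *)
have yM t : (N <= t)%N -> a t - g * t%:R <= M.
  elim: t => [//|t IH]; rewrite leq_eqVlt => /orP[/eqP<-|].
    by rewrite le_max lexx.
  rewrite ltnS => Nt; have yt := IH Nt.
  have t0 : 0 < t%:R :> R by rewrite ltr0n; apply: leq_trans Nt.
  have ct : c / t%:R <= 1.
    rewrite ler_pdivrMr // mul1r; apply: (le_trans (ltW HN2)); rewrite ler_nat.
    by apply: leq_trans Nt; rewrite leqW // leq_maxr.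
  have ct0 : 0 <= c / t%:R by rewrite divr_ge0 // ltW.
  have bt : b t <= g * (1 + c).
    rewrite gE; apply: Hb; apply: leq_trans Nt; by rewrite leqW // leq_maxl.
  have at1 : a t.+1 <= (1 - c / t%:R) * a t + b t.
    by apply: rec; rewrite -(ltr0n R).
  have cg : c / t%:R * (g * t%:R) = c * g by field; rewrite gt_eqF.
  rewrite -[t.+1%:R]natr1.
  set x := c / t%:R in ct ct0 at1 cg.
  apply: (@le_trans _ _ ((1 - x) * (a t - g * t%:R))); first by nra.
  by nra.
have [N3 HN3] := @limsup_le_inv M (e / 2) (divr_gt0 e0 (ltr0Sn _ _)).
exists (maxn N N3) => t; rewrite geq_max => /andP[Nt /HN3].
rewrite add0r => Mt.
have t0 : 0 < t%:R :> R by rewrite ltr0n; apply: leq_trans Nt.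
have -> : l / (1 + c) + e = g + e / 2 by rewrite /g; field; rewrite gt_eqF.
have := yM _ Nt; rewrite lerBlDl => at_le.
rewrite ler_pdivrMr //; apply: (le_trans at_le); rewrite [leRHS]mulrDl lerD2l.
by rewrite -ler_pdivrMr.
Qed.

Lemma limn_esup_le v l :
  (forall e, 0 < e -> exists N, forall n, (N <= n)%N -> (v n <= (l + e)%:E)%E) ->
  (limn_esup v <= l%:E)%E.
Proof.
move=> H; apply/lee_addgt0Pr => e /H[N {}H]; rewrite -EFinD.
rewrite /limn_esup limf_esupE.
apply: (@le_trans _ _ (ereal_sup (v @` [set n | (N <= n)%N])%classic)).
  by apply: ereal_inf_lbound; exists [set n | (N <= n)%N]%classic => //; exists N.
by apply: ge_ereal_sup => _ [n /= Nn <-]; exact: H.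
Qed.

Lemma limn_esup_le_of_limsup v u l :
  (forall n, (0 < n)%N -> v n = (u n)%:E) -> limsup_le u l ->
  (limn_esup v <= l%:E)%E.
Proof.
move=> vu H; apply: limn_esup_le => e /H[N {}H]; exists N.+1 => n Nn.
by rewrite vu ?lee_fin ?H //; [exact: ltnW | exact: leq_trans Nn].
Qed.

Lemma limn_einf_ge_of_limsup v u l :
  (forall n, (0 < n)%N -> v n = (u n)%:E) -> limsup_le (fun n => - u n) (- l) ->
  (l%:E <= limn_einf v)%E.
Proof.
move=> vu H; rewrite /limn_einf leeNr -EFinN.
by apply: (limn_esup_le_of_limsup (u := fun n => - u n)) => // n /vu ->.
Qed.

End LimSup.

(** * From random variables to finite sums *)

Section FiniteValued.
Context d (T : measurableType d) (R : realType) (P : probability T R).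

Definition law (F : Type) (X : T -> F) (x : F) : R :=
  fine (P [set w | X w = x]%classic).

Lemma law_ge0 (F : Type) (X : T -> F) x : 0 <= law X x.
Proof. exact: fine_ge0. Qed.

Variables (F : finType) (X : T -> F).
Hypothesis mX : forall x, measurable [set w | X w = x]%classic.

Lemma measurable_mem_seq (s : seq F) : measurable [set w | X w \in s]%classic.
Proof.
elim: s => [|x s IH]; first by rewrite (_ : mkset _ = set0) // -subset0.
rewrite (_ : mkset _ = ([set w | X w = x] `|` [set w | X w \in s])%classic).
  exact: measurableU.
by apply/seteqP; split => w /=; rewrite inE => /predU1P.
Qed.

Lemma prob_mem_seq (s : seq F) : uniq s ->
  fine (P [set w | X w \in s]%classic) = \sum_(x <- s) law X x.
Proof.
elim: s => [_|x s IH /= /andP[xs us]].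
  by rewrite big_nil (_ : mkset _ = set0) ?measure0 // -subset0.
rewrite big_cons -IH // /law -fineD ?fin_num_measure //; last first.
  exact: measurable_mem_seq.
rewrite -measureU //; [|exact: measurable_mem_seq|].
  congr (fine (P _)); apply/seteqP; split => w /=; rewrite inE => /predU1P //.
rewrite -subset0 => w [/= ->]; exact/negP.
Qed.

Lemma prob_pred (Q : pred F) :
  fine (P [set w | Q (X w)]%classic) = \sum_(x | Q x) law X x.
Proof.
transitivity (\sum_(x <- enum Q) law X x); last exact: big_enum.
rewrite -prob_mem_seq ?enum_uniq //.
by congr (fine (P _)); apply/seteqP; split => w /=; rewrite mem_enum.
Qed.

Lemma sum_law : \sum_x law X x = 1.
Proof.
rewrite -prob_pred (_ : mkset _ = setT) ?probability_setT //.
by apply/seteqP; split.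
Qed.

(** Change of variables, used to read the next graph off the present one and the
    neighbours of the new vertex. *)
Lemma sum_law_comp (F' : finType) (phi : F -> F') (f : F' -> R) :
  \sum_y law (phi \o X) y * f y = \sum_x law X x * f (phi x).
Proof.
rewrite [RHS](partition_big phi predT) //=; apply: eq_bigr => y _.
rewrite {1}/law (_ : mkset _ = [set w | phi (X w) == y]%classic).
  rewrite (prob_pred (fun x => phi x == y)) mulr_suml.
  by apply: eq_bigr => x /eqP ->.
by apply/seteqP; split => w /= /eqP.
Qed.

Lemma expectation_law (f : F -> R) : (forall x, 0 <= f x) ->
  'E_P[f \o X]%E = (\sum_x law X x * f x)%:E.
Proof.
move=> f0; rewrite expectation.unlock.
transitivity (\int[P]_w (\sum_x (f x)%:E * (\1_[set w | X w = x]%classic w)%:E))%E.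
  apply: eq_integral => w _; rewrite (bigD1 (X w)) //= indicE mem_set // mule1.
  rewrite big1 ?adde0 // => x /eqP xX.
  by rewrite indicE memNset ?mule0 // => /= Xx; apply: xX.
rewrite ge0_integral_sum //=; first last.
- by move=> x w _; rewrite mule_ge0 ?lee_fin.
- by move=> x; apply/measurable_EFinP; apply: measurable_funM => //;
    exact: measurable_indic.
rewrite -sumEFin; apply: eq_bigr => x _.
rewrite ge0_integralZl_EFin //; last first.
  by apply/measurable_EFinP; exact: measurable_indic.
by rewrite integral_indic // setIT /law muleC EFinM fineK // fin_num_measure.
Qed.

End FiniteValued.

Section Process.
Context d (T : measurableType d) (R : realType) (P : probability T R).
Variables (mu : R) (G : forall t : nat, T -> graph t.+1).
Hypothesis HG : random_graph_process P mu G.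

Let neighbours t w : {set 'I_t.+1} := [set x | new_edge x \in G t.+1 w].

Lemma process_add_vertex t w : (0 < t)%N ->
  G t.+1 w = add_vertex (G t w) (neighbours t w).
Proof.
move=> t0; have [N GN] := process_step HG w t0.
rewrite GN; congr add_vertex; apply/setP => x.
by rewrite inE GN mem_new_edge_add_vertex.
Qed.

Let state t w : graph t.+1 * {set 'I_t.+1} := (G t w, neighbours t w).

Lemma measurable_state t x : (0 < t)%N ->
  measurable [set w | state t w = x]%classic.
Proof.
case: x => g N t0.
rewrite (_ : mkset _ = ([set w | G t w = g] `&`
                        [set w | G t.+1 w = add_vertex g N])%classic).
  by apply: measurableI; apply: (process_measurable HG).
apply/seteqP; split => w /=; first by case=> <- <-; rewrite -process_add_vertex.
case=> gE; rewrite /state gE => GE; congr pair.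
by apply/setP => x; rewrite inE GE mem_new_edge_add_vertex.
Qed.

Lemma mem_bigsetI (I : finType) (J : {set I}) (A : I -> set T) w :
  (\big[setI/setT]_(i in J) A i)%classic w <-> forall i, i \in J -> A i w.
Proof.
rewrite -bigcap_seq_cond; split=> [H i iJ | H i /= /andP[_ /H] //].
by apply: H; rewrite /= mem_index_enum.
Qed.

(** The Markov kernel of the process.  Both sides have the same superset sums in N:
    on the left by the product rule for the conditional probabilities, on the right
    by the definition of the Bernoulli weight. *)
Lemma law_state t g N : (0 < t)%N ->
  law P (state t) (g, N) = law P (G t) g * bernoulli_weight (attach_prob mu g) N.
Proof.
move=> t0; have mG g' : measurable [set w | G t w = g']%classic.
  exact: (process_measurable HG).
have ms x : measurable [set w | state t w = x]%classic by exact: measurable_state.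
have := law_ge0 P (G t) g; rewrite le_eqVlt => /predU1P[L0|L0].
  (* If g has probability 0, so has every joint event. *)
  rewrite -L0 mul0r; apply/eqP; rewrite eq_le law_ge0 andbT L0.
  apply: fine_le; rewrite ?fin_num_measure //.
  by apply: le_measure; rewrite ?inE // => w /= [].
move: N; apply: eq_superset_sums => J.
rewrite -mulr_sumr sum_bernoulli_weight_superset.
have PB : (0 < P [set w | G t w = g]%classic)%E.
  by move: L0; rewrite /law -lte_fin fineK // fin_num_measure.
have := process_indep HG t0 PB J.
rewrite (eq_bigr (attach_prob mu g)); last first.
  by move=> x _; exact: (process_prob HG t0 PB x).
move=> <-; rewrite /cond_prob mulrC divfK ?gt_eqF //.
pose Q (x : graph t.+1 * {set 'I_t.+1}) := (x.1 == g) && (J \subset x.2).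
transitivity (fine (P [set w | Q (state t w)]%classic)).
  rewrite (prob_pred P ms Q) (reindex_onto (pair g) (fun x => x.2)) /=; last first.
    by case=> g' N /andP[/= /eqP ->].
  by apply: eq_bigl => N; rewrite /Q /= !eqxx andbT.
congr (fine (P _)); apply/seteqP; split => w /=.
  move=> /andP[/eqP gE /fintype.subsetP JN]; split => //.
  by apply/mem_bigsetI => x /JN; rewrite inE.
move=> [/mem_bigsetI JN gE]; rewrite /Q /= gE eqxx; apply/fintype.subsetP => x /JN.
by rewrite inE.
Qed.

(** A finite sum rather than an integral, so that conditioning on the graph at time
    t is a rearrangement of sums. *)
Definition graph_mean t (f : graph t.+1 -> R) : R := \sum_g law P (G t) g * f g.
Arguments graph_mean t f : clear implicits.

Lemma graph_mean_step t f : (0 < t)%N ->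
  graph_mean t.+1 f = graph_mean t (fun g =>
    \sum_N bernoulli_weight (attach_prob mu g) N * f (add_vertex g N)).
Proof.
move=> t0; rewrite /graph_mean.
pose next (x : graph t.+1 * {set 'I_t.+1}) := add_vertex x.1 x.2.
have -> : G t.+1 = next \o state t.
  by apply/funext => w; rewrite (process_add_vertex _ t0).
rewrite sum_law_comp; last by move=> x; exact: measurable_state.
under [RHS]eq_bigr => g _ do rewrite mulr_sumr.
rewrite pair_big; apply: eq_bigr => -[g N] _ /=.
by rewrite law_state // mulrA.
Qed.

Definition nonempty_simple n (g : graph n) : Prop :=
  simple_graph g /\ (0 < num_edges g)%N.

Lemma process_simple t w : (0 < t)%N -> nonempty_simple (G t w).
Proof.
elim: t => // -[_ _|t IH _].
  rewrite (process_start HG) /nonempty_simple /num_edges cards1; split=> // e.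
  by rewrite inE => /eqP ->; rewrite cards2.
rewrite process_add_vertex //; have [|sg eg] := IH _ => //.
split; first exact: simple_add_vertex.
by rewrite num_edges_add_vertex ltn_addr.
Qed.

Section Means.
Variable t : nat.
Hypothesis t0 : (0 < t)%N.
Implicit Types f h : graph t.+1 -> R.

Lemma graph_mean_le f h : (forall w, f (G t w) <= h (G t w)) ->
  graph_mean t f <= graph_mean t h.
Proof.
move=> fh; apply: ler_sum => g _.
have [[w <-]|gN] := pselect (exists w, G t w = g).
  by rewrite ler_wpM2l ?law_ge0.
rewrite /law (_ : mkset _ = set0) ?measure0 ?mul0r //.
by rewrite -subset0 => w /= Gw; apply: gN; exists w.
Qed.

Lemma graph_meanD f h :
  graph_mean t (fun g => f g + h g) = graph_mean t f + graph_mean t h.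
Proof. by rewrite -big_split; apply: eq_bigr => g _; rewrite mulrDr. Qed.

Lemma graph_meanZ c f : graph_mean t (fun g => c * f g) = c * graph_mean t f.
Proof. by rewrite mulr_sumr; apply: eq_bigr => g _; rewrite mulrCA. Qed.

Lemma graph_mean_cst c : graph_mean t (fun=> c) = c.
Proof.
rewrite /graph_mean -mulr_suml sum_law ?mul1r // => g.
exact: (process_measurable HG).
Qed.

Lemma mean_num_degreeE k :
  mean_num_degree P G k t = (graph_mean t (fun g => (num_degree k g)%:R))%:E.
Proof.
rewrite /mean_num_degree -expectation_law // => g.
exact: (process_measurable HG).
Qed.

End Means.

End Process.

Arguments graph_mean {d T R} P G t f.

(** * Drift of the edge and degree counts *)

(** Trades a first absolute moment for a second moment: applied to
    z = (e_t - mu t) / t, whose mean square is O(1/t), it shows that the mean of |z|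
    is eventually below any s > 0 up to a constant factor. *)
Lemma norm_le_AMGM (R : realType) (z s : R) : 0 < s -> `|z| <= s + z ^+ 2 / (4 * s).
Proof.
move=> s0; rewrite -(@ler_pM2r _ (4 * s)); last by lra.
have -> : (s + z ^+ 2 / (4 * s)) * (4 * s) = 4 * s ^+ 2 + z ^+ 2.
  by field; rewrite gt_eqF.
have := sqr_ge0 (2 * s - `|z|); rewrite -(real_normK (num_real z)).
nra.
Qed.

Section Attachment.
Variables (R : realType) (mu : R).
Hypotheses (mu0 : 0 < mu) (mu2 : mu <= 2).
Variables (n : nat) (g : graph n).
Hypothesis g_ok : nonempty_simple g.

Let e : R := (num_edges g)%:R.

Let e1 : 1 <= e.
Proof. by rewrite ler1n; case: g_ok. Qed.

(** The truncation is inactive because the degree is at most the number of edges and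
    mu <= 2. *)
Lemma attach_probE x : attach_prob mu g x = mu / (2 * e) * (degree g x)%:R.
Proof.
rewrite /attach_prob min_l; first by rewrite mulrAC.
have e1' := e1; rewrite ler_pdivrMr -/e; last by lra.
rewrite mul1r; apply: ler_pM => //; first exact: ltW.
by rewrite ler_nat degree_le.
Qed.

Lemma attach_prob01 x : 0 <= attach_prob mu g x <= 1.
Proof.
rewrite {2}/attach_prob ge_min lexx orbT andbT attach_probE.
by rewrite mulr_ge0 // divr_ge0 ?mulr_ge0 // ltW.
Qed.

Lemma sum_attach_prob : \sum_x attach_prob mu g x = mu.
Proof.
under eq_bigr => x _ do rewrite attach_probE.
rewrite -mulr_sumr -natr_sum handshake; last by case: g_ok.
by have e1' := e1; rewrite natrM -/e; field; lra.
Qed.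

(** The sum is at most (mu / 2) (1 + 1/e), hence at most 3/2 from two edges on.  A
    single edge must be excluded: for mu = 2 both its ends are then joined to the
    new vertex with certainty. *)
Lemma attach_prob_pair x y : (2 <= num_edges g)%N -> x != y ->
  attach_prob mu g x + attach_prob mu g y <= 3 / 2.
Proof.
move=> e2 xy; rewrite !attach_probE -mulrDr -natrD.
have e2' : 2 <= e by rewrite (ler_nat R 2).
have : (degree g x + degree g y)%:R <= e + 1.
  by rewrite natr1 ler_nat degree_pair_le //; case: g_ok.
set D := _%:R => De.
have D0 : 0 <= D by [].
rewrite mulrAC ler_pdivrMr; last by lra.
apply: (@le_trans _ _ (2 * (e + 1))); last by lra.
by apply: ler_pM => //; exact: ltW.
Qed.

Definition new_degree_prob k : R :=
  \sum_(N : {set 'I_n} | #|N| == k) bernoulli_weight (attach_prob mu g) N.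

Lemma new_degree_prob_ge0 k : 0 <= new_degree_prob k.
Proof.
by apply: sumr_ge0 => N _; apply: bernoulli_weight_ge0; exact: attach_prob01.
Qed.

Lemma new_degree_prob_le k : new_degree_prob k <= expR mu * 2 ^- k.
Proof.
rewrite -[X in expR X]sum_attach_prob; apply: bernoulli_card_tail.
exact: attach_prob01.
Qed.

Lemma new_degree_prob1_ge : (2 <= num_edges g)%N ->
  3 / 8 * mu * expR (- (4 * mu)) <= new_degree_prob 1.
Proof.
move=> e2; have := @bernoulli_card1_ge _ _ _ attach_prob01.
rewrite sum_attach_prob; apply => //.
by move=> x y; exact: attach_prob_pair.
Qed.

(** Bias-variance decomposition: the increment of the number of edges has mean mu
    and variance at most mu. *)
Lemma mean_sq_num_edges_step c :
  \sum_N bernoulli_weight (attach_prob mu g) N *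
    ((num_edges (add_vertex g N))%:R - (c + mu)) ^+ 2 <= (e - c) ^+ 2 + mu.
Proof.
set W := bernoulli_weight _.
have -> : \sum_N W N * ((num_edges (add_vertex g N))%:R - (c + mu)) ^+ 2 =
  (e - c) ^+ 2 * \sum_N W N + 2 * (e - c) * (\sum_N W N * #|N|%:R - mu * \sum_N W N)
  + \sum_N W N * (#|N|%:R - mu) ^+ 2.
  rewrite !mulr_sumr -sumrB mulr_sumr -!big_split /=.
  by apply: eq_bigr => N _; rewrite num_edges_add_vertex natrD -/e; ring.
rewrite sum_bernoulli_weight bernoulli_mean sum_attach_prob mulr1 mulr1 subrr.
rewrite mulr0 addr0 lerD2l.
by have := bernoulli_variance_le attach_prob01; rewrite sum_attach_prob.
Qed.

(** A vertex of degree k is promoted with probability mu k / (2e); the last term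
    accounts for the new vertex. *)
Lemma mean_num_degree_add_vertex k :
  \sum_N bernoulli_weight (attach_prob mu g) N *
    (num_degree k.+1 (add_vertex g N))%:R =
  (num_degree k.+1 g)%:R
  - mu / (2 * e) * (k.+1%:R * (num_degree k.+1 g)%:R)
  + mu / (2 * e) * (k%:R * (num_degree k g)%:R)
  + new_degree_prob k.+1.
Proof.
set W := bernoulli_weight _.
under eq_bigr => N _ do rewrite num_degree_add_vertex mulrDr.
rewrite big_split /=; congr (_ + _); last first.
  rewrite /new_degree_prob [RHS]big_mkcond; apply: eq_bigr => N _.
  by case: ifP; rewrite /= ?mulr1 ?mulr0.
under eq_bigr => N _ do rewrite mulr_sumr.
rewrite exchange_big /= !num_degree_sum !mulr_sumr -sumrB -big_split /=.
apply: eq_bigr => x _; rewrite eqSS.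
set a := (_ == k.+1)%:R; set b := (_ == k)%:R.
have -> : \sum_N W N * (a + (x \in N)%:R * b - (x \in N)%:R * a) =
  a * \sum_N W N + (b - a) * \sum_N W N * (x \in N)%:R.
  by rewrite !mulr_sumr -big_split; apply: eq_bigr => N _ /=; ring.
rewrite sum_bernoulli_weight sum_bernoulli_weight_mem attach_probE mulr1.
have -> : k.+1%:R * a = (degree g x)%:R * a.
  by rewrite /a; case: eqP => [->|]; rewrite ?mulr0.
have -> : k%:R * b = (degree g x)%:R * b.
  by rewrite /b; case: eqP => [->|]; rewrite ?mulr0.
ring.
Qed.

(** Replacing e by mu t in the drift changes it by (al - be) (e - mu t) / t, where
    al and be are the shares of the total degree carried by the vertices of degree
    k + 1 and k; these lie in [0, 1], so the error does not grow with k. *)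
Lemma num_degree_drift_error k (t s : R) : 0 < t -> 0 < s ->
  `| \sum_N bernoulli_weight (attach_prob mu g) N *
      (num_degree k.+1 (add_vertex g N))%:R
     - ((1 - k.+1%:R / 2 / t) * (num_degree k.+1 g)%:R
        + k%:R / 2 / t * (num_degree k g)%:R + new_degree_prob k.+1) | <=
  s + (e - mu * t) ^+ 2 / (4 * s * t ^+ 2).
Proof.
move=> t0 s0; rewrite mean_num_degree_add_vertex.
set A := (num_degree k.+1 g)%:R; set B := (num_degree k g)%:R.
set z := (e - mu * t) / t; set q := new_degree_prob _.
have e0 : 0 < e by have := e1; lra.
pose al := k.+1%:R * A / (2 * e); pose be := k%:R * B / (2 * e).
have al01 : 0 <= al <= 1.
  rewrite divr_ge0 ?mulr_ge0 ?(ltW e0) //= ler_pdivrMr ?mulr_gt0 // mul1r.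
  by apply: num_degree_edges_le; case: g_ok.
have be01 : 0 <= be <= 1.
  rewrite divr_ge0 ?mulr_ge0 ?(ltW e0) //= ler_pdivrMr ?mulr_gt0 // mul1r.
  by apply: num_degree_edges_le; case: g_ok.
rewrite (_ : _ - _ = (al - be) * z); last first.
  by rewrite /al /be /z; field; rewrite !gt_eqF.
have -> : s + (e - mu * t) ^+ 2 / (4 * s * t ^+ 2) = s + z ^+ 2 / (4 * s).
  by rewrite /z; field; rewrite !gt_eqF.
apply: le_trans (norm_le_AMGM z s0); rewrite normrM ler_piMl //.
by rewrite ler_norml; apply/andP; split; lra.
Qed.

End Attachment.

Section Dynamics.
Context d (T : measurableType d) (R : realType) (P : probability T R).
Variables (mu : R) (G : forall t : nat, T -> graph t.+1).
Hypotheses (mu0 : 0 < mu) (mu2 : mu <= 2).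
Hypothesis HG : random_graph_process P mu G.

Local Notation EG := (graph_mean P G).

Lemma mean_sq_num_edges t : (0 < t)%N ->
  EG t (fun g => ((num_edges g)%:R - mu * t%:R) ^+ 2) <= 2 * t%:R.
Proof.
elim: t => // -[_ _|t IH _].
  rewrite -[leRHS](graph_mean_cst HG (ltn0Sn 0)); apply: graph_mean_le => w.
  rewrite (process_start HG) /num_edges cards1 !mulr1 expr2.
  have : 0 <= mu * (2 - mu) by rewrite mulr_ge0 ?subr_ge0 // ltW.
  by nra.
rewrite (graph_mean_step HG) //; apply: (@le_trans _ _ (EG t.+1 (fun g =>
  ((num_edges g)%:R - mu * t.+1%:R) ^+ 2 + mu))).
  apply: graph_mean_le => w; rewrite -[t.+2%:R]natr1 mulrDr mulr1.
  by apply: mean_sq_num_edges_step => //; exact: (process_simple HG w).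
rewrite graph_meanD (graph_mean_cst HG) // -[t.+2%:R]natr1 mulrDr mulr1.
by apply: lerD => //; exact: IH.
Qed.

Definition mean_degree_count k t : R := EG t (fun g => (num_degree k g)%:R).
Definition mean_new_degree_prob k t : R := EG t (fun g => new_degree_prob mu g k).

Lemma mean_degree_count_step k t s : (0 < t)%N -> 0 < s ->
  `|mean_degree_count k.+1 t.+1 -
    ((1 - k.+1%:R / 2 / t%:R) * mean_degree_count k.+1 t
     + k%:R / 2 / t%:R * mean_degree_count k t
     + mean_new_degree_prob k.+1 t)| <= s + (2 * s)^-1 / t%:R.
Proof.
move=> t0 s0; have t0' : 0 < t%:R :> R by rewrite ltr0n.
set c1 := 1 - _; set c2 := k%:R / 2 / _.
pose h (g : graph t.+1) : R :=
  \sum_N bernoulli_weight (attach_prob mu g) N *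
    (num_degree k.+1 (add_vertex g N))%:R.
pose m (g : graph t.+1) : R := c1 * (num_degree k.+1 g)%:R
  + c2 * (num_degree k g)%:R + new_degree_prob mu g k.+1.
pose r (g : graph t.+1) : R :=
  s + (4 * s * t%:R ^+ 2)^-1 * ((num_edges g)%:R - mu * t%:R) ^+ 2.
have Em : EG t m = c1 * mean_degree_count k.+1 t + c2 * mean_degree_count k t
                   + mean_new_degree_prob k.+1 t.
  by rewrite /m !graph_meanD !graph_meanZ.
have Er : EG t r <= s + (2 * s)^-1 / t%:R.
  rewrite graph_meanD graph_meanZ (graph_mean_cst HG) // lerD2l.
  apply: (@le_trans _ _ ((4 * s * t%:R ^+ 2)^-1 * (2 * t%:R))).
    apply: ler_wpM2l (mean_sq_num_edges t0).
    by rewrite invr_ge0 !mulr_ge0 ?exprn_ge0 // ltW.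
  by rewrite le_eqVlt; apply/orP; left; apply/eqP; field; rewrite !gt_eqF.
have hm w : `|h (G t w) - m (G t w)| <= r (G t w).
  rewrite /r [_^-1 * _]mulrC; apply: num_degree_drift_error => //.
  exact: (process_simple HG w).
rewrite {1}/mean_degree_count (graph_mean_step HG) // -/h -Em.
rewrite ler_norml lerBlDr lerBrDl; apply/andP; split.
  apply: (@le_trans _ _ (EG t m + -1 * EG t r)); first by rewrite mulN1r; lra.
  rewrite -graph_meanZ -graph_meanD; apply: graph_mean_le => w.
  by have := hm w; rewrite ler_norml => /andP[+ _]; rewrite mulN1r; lra.
apply: (@le_trans _ _ (EG t m + EG t r)); last by lra.
rewrite -graph_meanD; apply: graph_mean_le => w.
by have := hm w; rewrite ler_norml => /andP[_]; lra.
Qed.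

Lemma mean_new_degree_prob_ge0 k t : (0 < t)%N -> 0 <= mean_new_degree_prob k t.
Proof.
move=> t0; rewrite -[leLHS](graph_mean_cst HG t0); apply: graph_mean_le => w.
by apply: new_degree_prob_ge0 => //; exact: (process_simple HG w).
Qed.

Lemma mean_new_degree_prob_le k t : (0 < t)%N ->
  mean_new_degree_prob k t <= expR mu * 2 ^- k.
Proof.
move=> t0; rewrite -[leRHS](graph_mean_cst HG t0); apply: graph_mean_le => w.
by apply: new_degree_prob_le => //; exact: (process_simple HG w).
Qed.

(** The bound on the conditional probability holds as soon as there are two edges.
    Having fewer is a deviation of e_t from mu t by at least mu t / 2, which
    Chebyshev makes rare. *)
Lemma mean_new_degree_prob1_ge t (c := 3 / 8 * mu * expR (- (4 * mu))) :
  (0 < t)%N -> 2 <= mu * t%:R ->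
  c * (1 - 8 / mu ^+ 2 / t%:R) <= mean_new_degree_prob 1 t.
Proof.
move=> t0 mut; have t0' : 0 < t%:R :> R by rewrite ltr0n.
have c0 : 0 <= c by rewrite !mulr_ge0 ?expR_ge0 // ltW.
pose b : R := c * (4 / (mu * t%:R) ^+ 2).
have b0 : 0 <= b by rewrite mulr_ge0 // divr_ge0 // sqr_ge0.
(* The subtracted term is at least c when there are fewer than two edges. *)
apply: (@le_trans _ _ (EG t (fun g =>
    c + - b * ((num_edges g)%:R - mu * t%:R) ^+ 2))).
  rewrite graph_meanD [X in _ <= _ + X]graph_meanZ (graph_mean_cst HG) //.
  rewrite mulrBr mulr1 lerD2l.
  rewrite mulNr lerN2; apply: (le_trans (ler_wpM2l b0 (mean_sq_num_edges t0))).
  by rewrite /b le_eqVlt; apply/orP; left; apply/eqP; field; rewrite !gt_eqF.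
apply: graph_mean_le => w; have gok := process_simple HG w t0.
have [e2|e1] := leqP 2 (num_edges (G t w)).
  (* At least two edges: drop the subtracted square. *)
  apply: le_trans (new_degree_prob1_ge mu0 mu2 gok e2).
  by rewrite /= mulNr gerBl mulr_ge0 // sqr_ge0.
(* At most one edge: the left-hand side is nonpositive. *)
apply: le_trans (new_degree_prob_ge0 mu0 mu2 gok 1).
have e1' : (num_edges (G t w))%:R <= 1 :> R by rewrite lern1 -ltnS.
rewrite /= mulNr subr_le0 /b -mulrA ler_peMr //.
rewrite mulrAC ler_pdivlMr ?exprn_gt0 ?mulr_gt0 // mul1r.
have := ler0n R (num_edges (G t w)); nra.
Qed.

End Dynamics.

(** * The power law *)

Section Profiles.
Variable R : realType.

(** The solution of the limiting recursion with source A 2^-k.  The factor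
    8 - (k^2 + 5k + 8) / 2^k is the sum of j (j+1) 2^-j over j <= k. *)
Definition upper_profile (A : R) (k : nat) : R :=
  2 * A * (8 - (k%:R ^+ 2 + 5 * k%:R + 8) / 2 ^+ k) /
  (k%:R * (k%:R + 1) * (k%:R + 2)).

(** The solution of the limiting recursion with source c at k = 1 only. *)
Definition lower_profile (c : R) (k : nat) : R :=
  4 * c / (k%:R * (k%:R + 1) * (k%:R + 2)).

Lemma upper_profileS A k :
  (k%:R / 2 * upper_profile A k + A * 2 ^- k.+1) / (1 + k.+1%:R / 2) =
  upper_profile A k.+1.
Proof.
rewrite /upper_profile; case: k => [|k].
  by rewrite mul0r mul0r add0r; field.
rewrite (exprS _ k.+1) -[k.+2%:R]natr1.
have : 0 < k.+1%:R :> R by []; move: k.+1%:R => x x0.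
have : 0 < 2 ^+ k.+1 :> R by rewrite exprn_gt0. move: (2 ^+ _) => y y0.
by field; rewrite !gt_eqF //; lra.
Qed.

Lemma lower_profileS c k :
  (k.+1%:R / 2 * lower_profile c k.+1) / (1 + k.+2%:R / 2) = lower_profile c k.+2.
Proof.
rewrite /lower_profile -[k.+2%:R]natr1.
have : 0 < k.+1%:R :> R by []; move: k.+1%:R => x x0.
by field; rewrite !gt_eqF //; lra.
Qed.

Lemma upper_profile_le A k : 0 <= A -> (0 < k)%N ->
  upper_profile A k <= 16 * A * k%:R ^- 3.
Proof.
move=> A0 k0; rewrite /upper_profile.
have : 0 < k%:R :> R by rewrite ltr0n.
have : 0 < 2 ^+ k :> R by rewrite exprn_gt0.
move: (2 ^+ k) k%:R => y x y0 x0.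
have den : x ^+ 3 <= x * (x + 1) * (x + 2) by nra.
have x30 : 0 < x ^+ 3 by rewrite exprn_gt0.
have d0 : 0 < x * (x + 1) * (x + 2) by rewrite !mulr_gt0 //; lra.
apply: (@le_trans _ _ (16 * A / (x * (x + 1) * (x + 2)))).
  rewrite ler_pM2r ?invr_gt0 //.
  have : 0 <= (x ^+ 2 + 5 * x + 8) / y by rewrite divr_ge0; nra.
  by nra.
by rewrite ler_wpM2l ?mulr_ge0 // lef_pV2 // posrE.
Qed.

Lemma lower_profile_ge c k : 0 <= c -> (0 < k)%N ->
  2 / 3 * c * k%:R ^- 3 <= lower_profile c k.
Proof.
move=> c0 k0; rewrite /lower_profile.
have : 1 <= k%:R :> R by rewrite ler1n.
move: k%:R => x x1; have x0 : 0 < x by lra.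
have d0 : 0 < x * (x + 1) * (x + 2) by rewrite !mulr_gt0 //; lra.
rewrite ler_pdivlMr // mulrAC ler_pdivrMr ?exprn_gt0 //.
have : x * (x + 1) * (x + 2) <= 6 * x ^+ 3 by nra.
nra.
Qed.

End Profiles.

Section Limits.
Context d (T : measurableType d) (R : realType) (P : probability T R).
Variables (mu : R) (G : forall t : nat, T -> graph t.+1).
Hypotheses (mu0 : 0 < mu) (mu2 : mu <= 2).
Hypothesis HG : random_graph_process P mu G.

Local Notation D := (mean_degree_count P G).
Local Notation Q := (mean_new_degree_prob P mu G).

(** One step in k of the limiting recursion.  The sign sg treats upper bounds
    (sg = 1) and lower bounds (sg = -1) at once. *)
Lemma limsup_mean_degree_count_step (sg : R) k x q : `|sg| = 1 ->
  limsup_le (fun t => k%:R / 2 * (sg * D k t / t%:R)) x ->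
  limsup_le (fun t => sg * Q k.+1 t) q ->
  limsup_le (fun t => sg * D k.+1 t / t%:R) ((x + q) / (1 + k.+1%:R / 2)).
Proof.
move=> sg1 Hx Hq.
pose b t := sg * (D k.+1 t.+1 - (1 - k.+1%:R / 2 / t%:R) * D k.+1 t).
apply: (@limsup_le_recursion _ (fun t => sg * D k.+1 t) b).
- by rewrite divr_ge0.
- by move=> t t0; rewrite /b; lra.
(* The error s + 1 / (2 s t) of one time step is o(1) since s is arbitrary. *)
apply: limsup_le_approx => s s0; rewrite -[_ + s]addr0.
have Hs := limsup_leD (limsup_leD (limsup_leD Hx Hq) (limsup_le_cst s))
  (limsup_le_inv (2 * s)^-1).
apply: le_limsup_le Hs => t t0 /=; rewrite /b.
have := mean_degree_count_step mu0 mu2 HG k t0 s0.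
set r := s + _; set Y := _ + Q _ _ => H.
have {}H : sg * (D k.+1 t.+1 - Y) <= r.
  by apply: le_trans (ler_norm _) _; rewrite normrM sg1 mul1r.
apply: (@le_trans _ _ (sg * (D k.+1 t.+1 - Y) +
                       sg * (k%:R / 2 / t%:R * D k t + Q k.+1 t))).
  by rewrite /Y le_eqVlt; apply/orP; left; apply/eqP; ring.
have -> : k%:R / 2 * (sg * D k t / t%:R) + sg * Q k.+1 t + s + (2 * s)^-1 / t%:R =
  r + sg * (k%:R / 2 / t%:R * D k t + Q k.+1 t) by rewrite /r; ring.
by rewrite lerD2r.
Qed.

Lemma limsup_mean_degree_count k :
  limsup_le (fun t => D k.+1 t / t%:R) (upper_profile (expR mu) k.+1).
Proof.
have e1 : `|1 : R| = 1 by rewrite normr1.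
suff : limsup_le (fun t => 1 * D k.+1 t / t%:R) (upper_profile (expR mu) k.+1).
  by apply: le_limsup_le => t _; rewrite mul1r.
have HQ j : limsup_le (fun t => 1 * Q j t) (expR mu * 2 ^- j).
  apply: le_limsup_le (limsup_le_cst _) => t t0; rewrite mul1r.
  exact: mean_new_degree_prob_le.
(* At k = 0 the inflow from vertices of degree 0 is multiplied by 0. *)
elim: k => [|k IH]; rewrite -upper_profileS;
  apply: limsup_mean_degree_count_step => //.
  apply: le_limsup_le (limsup_le_cst _) => t t0 /=; by rewrite !mul0r.
exact: limsup_leZ.
Qed.

Lemma liminf_mean_degree_count k :
  limsup_le (fun t => - (D k.+1 t / t%:R))
    (- lower_profile (3 / 8 * mu * expR (- (4 * mu))) k.+1).
Proof.
set c := 3 / 8 * _ * _.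
have e1 : `|-1 : R| = 1 by rewrite normrN normr1.
suff : limsup_le (fun t => -1 * D k.+1 t / t%:R) (- lower_profile c k.+1).
  by apply: le_limsup_le => t _; rewrite mulN1r mulNr.
elim: k => [|k IH].
  have -> : - lower_profile c 1 = (0 + - c) / (1 + 1 / 2).
    by rewrite /lower_profile; field.
  apply: limsup_mean_degree_count_step => //.
    by apply: le_limsup_le (limsup_le_cst _) => t t0 /=; rewrite !mul0r.
  have H := limsup_leD (limsup_le_cst (- c)) (limsup_le_inv (c * (8 / mu ^+ 2))).
  move=> e e0; have [N1 HN1] := H _ e0.
  have [N2 HN2] : exists N, 2 / mu < N%:R.
    by exists (Num.bound (2 / mu)); apply: archi_boundP; rewrite divr_ge0 // ltW.
  exists (maxn N1 N2).+1 => t Nt.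
  have t0 : (0 < t)%N by exact: leq_trans Nt.
  have := HN1 t (leq_trans (leq_trans (leq_maxl _ _) (leqnSn _)) Nt).
  have mut : 2 <= mu * t%:R.
    rewrite -ler_pdivrMl // mulrC; apply: (le_trans (ltW HN2)); rewrite ler_nat.
    exact: (leq_trans (leq_trans (leq_maxr _ _) (leqnSn _)) Nt).
  have := mean_new_degree_prob1_ge mu0 mu2 HG t0 mut; rewrite -/c; lra.
have -> : - lower_profile c k.+2 =
    (k.+1%:R / 2 * - lower_profile c k.+1 + 0) / (1 + k.+2%:R / 2).
  by rewrite -lower_profileS addr0 mulrN mulNr.
apply: limsup_mean_degree_count_step => //; first exact: limsup_leZ.
apply: le_limsup_le (limsup_le_cst _) => t t0; rewrite mulN1r oppr_le0.
exact: mean_new_degree_prob_ge0.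
Qed.

End Limits.

Theorem theorem1p1 (R : realType) (mu : R) (hmu0 : 0 < mu) (hmu2 : mu <= 2) :
  exists C1 C2 : R, 0 < C1 /\ 0 < C2 /\
    forall (d : measure_display) (T : measurableType d) (P : probability T R)
      (G : forall t : nat, T -> graph t.+1),
      random_graph_process P mu G ->
      forall k : nat, (1 <= k)%N ->
        ((C1 * k%:R ^- 3)%:E
           <= limn_einf (fun t => mean_num_degree P G k t * (t%:R^-1)%:E))%E /\
        (limn_einf (fun t => mean_num_degree P G k t * (t%:R^-1)%:E)
           <= limn_esup (fun t => mean_num_degree P G k t * (t%:R^-1)%:E))%E /\
        (limn_esup (fun t => mean_num_degree P G k t * (t%:R^-1)%:E)
           <= (C2 * k%:R ^- 3)%:E)%E.
Proof.
pose c := 3 / 8 * mu * expR (- (4 * mu)).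
have c0 : 0 < c by rewrite !mulr_gt0 ?expR_gt0.
exists (2 / 3 * c), (16 * expR mu); split; first by rewrite mulr_gt0 // divr_gt0.
split; first by rewrite mulr_gt0 ?expR_gt0.
move=> d T P G HG [//|k] _.
have vE t : (0 < t)%N -> (mean_num_degree P G k.+1 t * (t%:R^-1)%:E)%E =
    (mean_degree_count P G k.+1 t / t%:R)%:E.
  by move=> t0; rewrite (mean_num_degreeE HG).
split; last split.
- apply: (@le_trans _ _ (lower_profile c k.+1)%:E).
    by rewrite lee_fin lower_profile_ge // ltW.
  exact: limn_einf_ge_of_limsup vE (liminf_mean_degree_count hmu0 hmu2 HG k).
- exact: limn_einf_sup.
apply: (@le_trans _ _ (upper_profile (expR mu) k.+1)%:E).
  exact: limn_esup_le_of_limsup vE (limsup_mean_degree_count hmu0 hmu2 HG k).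
by rewrite lee_fin upper_profile_le ?expR_ge0.
Qed.
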